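(* Let $f(z)=\sum_{k=0}^\infty a_k z^k$ be an entire function with positive coefficients ($a_k>0$ for all $k\ge 0$) such that for every $l\in\mathbb{N}\cup\{0\}$ the remainder $R_l[f](z)=\sum_{k=l}^\infty a_k z^k$ belongs to the class $\mathcal{L-P}I$. Then $q_n(f)>3$ for all $n\ge 2$.
   Context: For an entire function $f(z)=\sum_{k=0}^\infty a_k z^k$ with positive coefficients, the second quotients are $q_n(f)=\dfrac{a_{n-1}^2}{a_{n-2}a_n}$, $n\ge 2$. A real entire function $f$ belongs to the Laguerre--P\'olya class of type I, $\mathcal{L-P}I$, if $f(z)=c z^n e^{\beta z}\prod_{k=1}^\infty\left(1+\frac{z}{x_k}\right)$, where $c\in\mathbb{R}$, $\beta\ge 0$, $x_k>0$, $n$ is a nonnegative integer, and $\sum_{k} x_k^{-1}<\infty$; the product may be finite or empty (an empty product equals 1). *)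

(* Defs.v *)
From Stdlib Require Import Reals.
From Coquelicot Require Import Coquelicot.

Open Scope R_scope.

Definition Cexp (z : C) : C :=
  (exp (Re z) * cos (Im z), exp (Re z) * sin (Im z)).

(* Coquelicot's [Series] is real-valued only; a complex series converges iff
   its real and imaginary parts do, so its sum is taken componentwise. *)
Definition CSeries (u : nat -> C) : C :=
  (Series (fun k => Re (u k)), Series (fun k => Im (u k))).

(* f is entire with Taylor expansion sum_k a_k z^k, the a_k being real:
   the series converges to f z at every complex z. *)
Definition entire_expansion (f : C -> C) (a : nat -> R) : Prop :=
  forall z : C, is_pseries (fun k => RtoC (a k)) z (f z).

Definition real_entire (f : C -> C) : Prop :=
  exists a : nat -> R, entire_expansion f a.

Definition remainder (a : nat -> R) (l : nat) (z : C) : C :=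
  CSeries (fun k => (RtoC (a (l + k)%nat) * z ^ (l + k))%C).

(* Meaningful only for n >= 2, because of truncated subtraction on nat. *)
Definition second_quotient (a : nat -> R) (n : nat) : R :=
  (a (n - 1)%nat) ^ 2 / (a (n - 2)%nat * a n).

(* (1 + z / x_0) ... (1 + z / x_(N-1)) *)
Fixpoint linear_factors (x : nat -> R) (N : nat) (z : C) : C :=
  match N with
  | O => RtoC 1
  | S M => (linear_factors x M z * (1 + z / RtoC (x M)))%C
  end.

Definition finite_LP1_product (P : C -> C) : Prop :=
  exists (N : nat) (x : nat -> R),
    (forall k, (k < N)%nat -> 0 < x k) /\
    (forall z, P z = linear_factors x N z).

Definition infinite_LP1_product (P : C -> C) : Prop :=
  exists x : nat -> R,
    (forall k, 0 < x k) /\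
    ex_series (fun k => / x k) /\
    (forall z, filterlim (fun N => linear_factors x N z)
                         eventually (locally (P z))).

Definition LP1 (f : C -> C) : Prop :=
  real_entire f /\
  exists (c : R) (n : nat) (beta : R) (P : C -> C),
    0 <= beta /\
    (finite_LP1_product P \/ infinite_LP1_product P) /\
    (forall z, f z = (RtoC c * z ^ n * Cexp (RtoC beta * z) * P z)%C).

(* Main.v *)
Require Import Defs.
From Stdlib Require Import Reals Lra Lia Factorial.
From Coquelicot Require Import Coquelicot.

Open Scope R_scope.

(** Write [b j = a (l + j)].  Dividing the [l]-th remainder by [z ^ l] gives
    [g z = b 0 + b 1 z + b 2 z^2 + ...], which is in LP I with [g 0 > 0], so on
    the positive axis [g t] is [b 0] times the limit of
    [exp (beta t) * prod_(k < N) (1 + t y_k)], where [beta >= 0] and the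
    [y_k >= 0] have a finite sum.  With [p1 = beta + sum y_k],
    [p2 = sum y_k^2], [p3 = sum y_k^3], Newton's identities express
    [p1, p2, p3] in the coefficients of [g], and

    - [p2 >= 0] says that the second quotients are at least 2;
    - the Cauchy-Schwarz inequality [p1 p3 >= p2^2] says
      [q_n + 3 / q_(n+1) >= 4].

    If [p2 > 0], equality in the second one forces [beta = 0] and all nonzero
    [y_k] equal; as the [y_k] are summable there are finitely many nonzero
    ones, and [g] would be a polynomial, which its positive coefficients
    forbid.  So the second inequality is strict as soon as [q_n > 2].

    If some [q_n < 3], then [3 - q_(m+1) >= 3/2 * (3 - q_m)] for all [m >= n] by
    the second inequality: the gap below 3 grows geometrically, which
    contradicts [q_m >= 2].  Hence all [q_n >= 3]; and [q_n = 3] is excluded,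
    since the strict inequality would give [q_(n+1) < 3].

    Newton's identities need the Taylor coefficients of order at most 3 of a
    limit of products.  They are obtained without differentiating a limit:
    when the Taylor coefficients are nonnegative, the remainder [r] of order 4
    satisfies [0 <= r t <= t^4 * r 1] on [(0, 1]] ([quartic_tail]).  This
    bound survives multiplication by [1 + t y] ([quartic_tail_exp_product]) and
    pointwise limits ([quartic_tail_lim]), and it determines the coefficients
    ([cubic_coefficients_unique]). *)

(** * Taylor polynomials of degree 3 with a quartic remainder *)

Definition cubic_error (F : R -> R) (b : nat -> R) (t : R) : R :=
  F t - (b 0%nat + b 1%nat * t + b 2%nat * t ^ 2 + b 3%nat * t ^ 3).

Definition quartic_tail (F : R -> R) (b : nat -> R) : Prop :=
  forall t, 0 < t <= 1 ->
    0 <= cubic_error F b t <= t ^ 4 * cubic_error F b 1.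

(** Each omitted term [b k * t ^ k] has [k >= 4], hence is at most
    [t ^ 4 * b k]. *)
Lemma quartic_tail_series (b : nat -> R) (F : R -> R) :
  (forall k, 0 <= b k) ->
  (forall t, 0 < t -> is_series (fun k => b k * t ^ k) (F t)) ->
  quartic_tail F b.
Proof.
  intros b_ge0 F_sum t [t_gt0 t_le1].
  assert (tail : forall s, 0 < s ->
    is_series (fun k => b (4 + k)%nat * s ^ (4 + k)) (cubic_error F b s)).
  { intros s s_gt0.
    apply (is_series_incr_n (fun k => b k * s ^ k) 4); [lia|].
    replace (plus _ _) with (F s); [now apply F_sum|].
    rewrite sum_n_Reals; unfold plus, cubic_error; simpl; ring. }
  pose proof (tail t t_gt0) as tail_t.
  assert (tail_1 : is_series (fun k => t ^ 4 * (b (4 + k)%nat * 1 ^ (4 + k)))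
                             (t ^ 4 * cubic_error F b 1))
    by exact (is_series_scal_l (t ^ 4) _ _ (tail 1 Rlt_0_1)).
  rewrite <- (is_series_unique _ _ tail_t), <- (is_series_unique _ _ tail_1).
  assert (term_ge0 : forall k, 0 <= b (4 + k)%nat * t ^ (4 + k)).
  { intros k; apply Rmult_le_pos; [apply b_ge0 | apply pow_le; lra]. }
  split.
  - replace 0 with (Series (fun _ : nat => 0 * 0)) by (rewrite Series_scal_l; ring).
    apply Series_le; [|now exists (cubic_error F b t)].
    intros k; rewrite Rmult_0_l; split; [lra | apply term_ge0].
  - apply Series_le; [|now eexists; exact tail_1].
    intros k; split; [apply term_ge0|].
    unfold scal; simpl; unfold mult; simpl.
    rewrite pow1.
    assert (t_pow : 0 <= t ^ k <= 1).
    { split; [apply pow_le; lra|].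
      rewrite <- (pow1 k); apply pow_incr; lra. }
    pose proof (b_ge0 (S (S (S (S k))))) as bk_ge0.
    assert (t4 : 0 <= t ^ 4) by (apply pow_le; lra).
    replace (b _ * (t * (t * (t * (t * t ^ k)))))
      with (t ^ 4 * b (S (S (S (S k)))) * t ^ k) by ring.
    replace (t * (t * (t * (t * 1))) * (b _ * (1 * (1 * (1 * (1 * 1))))))
      with (t ^ 4 * b (S (S (S (S k)))) * 1) by ring.
    apply Rmult_le_compat_l; [now apply Rmult_le_pos | lra].
Qed.

Lemma quartic_tail_lim (F : nat -> R -> R) (b : nat -> nat -> R)
    (G : R -> R) (e : nat -> R) :
  (forall N, quartic_tail (F N) (b N)) ->
  (forall t, 0 < t -> is_lim_seq (fun N => F N t) (G t)) ->
  (forall j, (j <= 3)%nat -> is_lim_seq (fun N => b N j) (e j)) ->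
  quartic_tail G e.
Proof.
  intros tails F_lim b_lim t t_range.
  assert (error_lim : forall s, 0 < s ->
    is_lim_seq (fun N => cubic_error (F N) (b N) s) (cubic_error G e s)).
  { intros s s_gt0; unfold cubic_error.
    apply is_lim_seq_minus'; [now apply F_lim|].
    repeat apply is_lim_seq_plus'; try apply is_lim_seq_mult';
      try apply is_lim_seq_const; apply b_lim; lia. }
  split.
  - apply (is_lim_seq_le (fun _ => 0) (fun N => cubic_error (F N) (b N) t)
             0 (cubic_error G e t)).
    + intros N; apply (tails N t t_range).
    + apply is_lim_seq_const.
    + apply error_lim; lra.
  - apply (is_lim_seq_le (fun N => cubic_error (F N) (b N) t)
             (fun N => t ^ 4 * cubic_error (F N) (b N) 1)
             (cubic_error G e t) (t ^ 4 * cubic_error G e 1)).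
    + intros N; apply (tails N t t_range).
    + apply error_lim; lra.
    + apply is_lim_seq_mult'; [apply is_lim_seq_const | apply error_lim; lra].
Qed.

Lemma zero_of_small (x K : R) :
  (forall t, 0 < t <= 1 -> Rabs x <= K * t) -> x = 0.
Proof.
  intros small.
  destruct (Req_dec x 0) as [|x_neq0]; [assumption|exfalso].
  pose proof (Rabs_pos_lt x x_neq0) as x_gt0.
  pose proof (small 1 ltac:(lra)) as K_ge.
  set (t := Rabs x / (2 * K)).
  assert (t_eq : 2 * (K * t) = Rabs x) by (unfold t; field; lra).
  assert (t_gt0 : 0 < t) by (unfold t; apply Rdiv_lt_0_compat; lra).
  assert (t_le1 : t <= 1) by nra.
  pose proof (small t (conj t_gt0 t_le1)); lra.
Qed.

Lemma cubic_zero_of_quartic_bound (c0 c1 c2 c3 K : R) :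
  (forall t, 0 < t <= 1 ->
     Rabs (c0 + c1 * t + c2 * t ^ 2 + c3 * t ^ 3) <= K * t ^ 4) ->
  c0 = 0 /\ c1 = 0 /\ c2 = 0 /\ c3 = 0.
Proof.
  intros bound.
  assert (K_ge0 : 0 <= K).
  { pose proof (bound 1 ltac:(lra)) as b1.
    pose proof (Rabs_pos (c0 + c1 * 1 + c2 * 1 ^ 2 + c3 * 1 ^ 3)); lra. }
  assert (A1 := Rle_abs c1); assert (A1' := Rle_abs (- c1)).
  assert (A2 := Rle_abs c2); assert (A2' := Rle_abs (- c2)).
  assert (A3 := Rle_abs c3); assert (A3' := Rle_abs (- c3)).
  rewrite Rabs_Ropp in A1', A2', A3'.
  (* Dividing by [t] turns a bound of order [i + 1] into one of order [i]. *)
  assert (divide : forall x y t, 0 < t -> Rabs (t * x) <= t * y -> Rabs x <= y).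
  { intros x y t t_gt0 H; rewrite Rabs_mult, (Rabs_pos_eq t) in H by lra.
    now apply Rmult_le_reg_l in H. }
  assert (z0 : c0 = 0).
  { apply (zero_of_small _ (Rabs c1 + Rabs c2 + Rabs c3 + K)); intros t Ht.
    specialize (bound t Ht).
    apply Rabs_le_between in bound; apply Rabs_le.
    assert (t ^ 2 <= t) by nra. assert (0 < t^2) by nra.
    assert (0 < t ^ 3 <= t) by (simpl in *; nra).
    assert (0 < t ^ 4 <= t) by (simpl in *; nra).
    split; nra. }
  assert (z1 : c1 = 0).
  { apply (zero_of_small _ (Rabs c2 + Rabs c3 + K)); intros t Ht.
    specialize (bound t Ht).
    replace (c0 + c1 * t + c2 * t ^ 2 + c3 * t ^ 3)
      with (t * (c1 + c2 * t + c3 * t ^ 2)) in bound by (rewrite z0; ring).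
    replace (K * t ^ 4) with (t * (K * t ^ 3)) in bound by ring.
    apply divide in bound; [|lra].
    apply Rabs_le_between in bound; apply Rabs_le.
    assert (0 < t ^ 2 <= t) by nra.
    assert (0 < t ^ 3 <= t) by (simpl in *; nra).
    split; nra. }
  assert (z2 : c2 = 0).
  { apply (zero_of_small _ (Rabs c3 + K)); intros t Ht.
    specialize (bound t Ht).
    replace (c0 + c1 * t + c2 * t ^ 2 + c3 * t ^ 3)
      with (t * (t * (c2 + c3 * t))) in bound by (rewrite z0, z1; ring).
    replace (K * t ^ 4) with (t * (t * (K * t ^ 2))) in bound by ring.
    apply divide in bound; [|lra]; apply divide in bound; [|lra].
    apply Rabs_le_between in bound; apply Rabs_le.
    assert (0 < t ^ 2 <= t) by nra.
    split; nra. }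
  assert (z3 : c3 = 0).
  { apply (zero_of_small _ K); intros t Ht.
    specialize (bound t Ht).
    replace (c0 + c1 * t + c2 * t ^ 2 + c3 * t ^ 3)
      with (t * (t * (t * c3))) in bound by (rewrite z0, z1, z2; ring).
    replace (K * t ^ 4) with (t * (t * (t * (K * t)))) in bound by ring.
    do 3 (apply divide in bound; [|lra]); exact bound. }
  auto.
Qed.

Lemma cubic_coefficients_unique (F G : R -> R) (b e : nat -> R) (c : R) :
  quartic_tail F b -> quartic_tail G e ->
  (forall t, 0 < t <= 1 -> F t = c * G t) ->
  forall j, (j <= 3)%nat -> b j = c * e j.
Proof.
  intros F_tail G_tail FG.
  destruct (cubic_zero_of_quartic_bound
    (b 0%nat - c * e 0%nat) (b 1%nat - c * e 1%nat)
    (b 2%nat - c * e 2%nat) (b 3%nat - c * e 3%nat)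
    (cubic_error F b 1 + Rabs c * cubic_error G e 1)) as [z0 [z1 [z2 z3]]].
  { intros t Ht.
    pose proof (F_tail t Ht) as F_t; pose proof (G_tail t Ht) as G_t.
    replace (b 0%nat - c * e 0%nat + (b 1%nat - c * e 1%nat) * t
             + (b 2%nat - c * e 2%nat) * t ^ 2 + (b 3%nat - c * e 3%nat) * t ^ 3)
      with (c * cubic_error G e t - cubic_error F b t)
      by (unfold cubic_error; rewrite (FG t Ht); ring).
    eapply Rle_trans; [apply Rabs_triang|].
    rewrite Rabs_Ropp, Rabs_mult.
    rewrite (Rabs_pos_eq (cubic_error G e t)), (Rabs_pos_eq (cubic_error F b t))
      by lra.
    pose proof (Rabs_pos c).
    assert (Rabs c * cubic_error G e t <= Rabs c * (t ^ 4 * cubic_error G e 1))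
      by (apply Rmult_le_compat_l; lra).
    lra. }
  intros j j_le3.
  destruct j as [|[|[|[|j]]]]; [lra..|lia].
Qed.

Lemma quartic_tail_near_0 (F : R -> R) (b : nat -> R) :
  quartic_tail F b ->
  exists K, 0 <= K /\ forall t, 0 < t <= 1 -> Rabs (F t - b 0%nat) <= K * t.
Proof.
  intros F_tail.
  exists (Rabs (b 1%nat) + Rabs (b 2%nat) + Rabs (b 3%nat) + cubic_error F b 1).
  pose proof (F_tail 1 ltac:(lra)) as F_1.
  pose proof (Rabs_pos (b 1%nat)); pose proof (Rabs_pos (b 2%nat));
    pose proof (Rabs_pos (b 3%nat)).
  split; [lra|intros t Ht].
  pose proof (F_tail t Ht) as F_t.
  replace (F t - b 0%nat)
    with (cubic_error F b t + (b 1%nat * t + b 2%nat * t ^ 2 + b 3%nat * t ^ 3))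
    by (unfold cubic_error; ring).
  assert (A1 := Rle_abs (b 1%nat)); assert (A1' := Rle_abs (- b 1%nat)).
  assert (A2 := Rle_abs (b 2%nat)); assert (A2' := Rle_abs (- b 2%nat)).
  assert (A3 := Rle_abs (b 3%nat)); assert (A3' := Rle_abs (- b 3%nat)).
  rewrite Rabs_Ropp in A1', A2', A3'.
  assert (0 < t ^ 2 <= t) by nra.
  assert (0 < t ^ 3 <= t) by (simpl in *; nra).
  assert (0 < t ^ 4 <= t) by (simpl in *; nra).
  apply Rabs_le; split; nra.
Qed.

(** The order of vanishing at 0: if [n > m] the right-hand side, divided by
    [t ^ m], tends to 0 while the left-hand side tends to [b 0 > 0]; if
    [n < m] then [c = 0], and [F] would vanish. *)
Lemma vanishing_order_unique (F G : R -> R) (b e : nat -> R) (c : R) (m n : nat) :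
  quartic_tail F b -> quartic_tail G e ->
  0 < b 0%nat -> e 0%nat = 1 ->
  (forall t, 0 < t <= 1 -> 0 < F t) ->
  (forall t, 0 < t <= 1 -> t ^ m * F t = c * t ^ n * G t) ->
  n = m.
Proof.
  intros F_tail G_tail b0_gt0 e0 F_gt0 FG.
  destruct (quartic_tail_near_0 F b F_tail) as [KF [KF_ge0 F_near]].
  destruct (quartic_tail_near_0 G e G_tail) as [KG [KG_ge0 G_near]].
  rewrite e0 in G_near.
  assert (pow_small : forall t k, 0 < t <= 1 -> 0 < t ^ k <= 1).
  { intros t k Ht; split; [apply pow_lt; lra|].
    rewrite <- (pow1 k); apply pow_incr; lra. }
  destruct (Nat.lt_trichotomy n m) as [n_lt|[n_eq|n_gt]]; [|assumption|]; exfalso.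
  - assert (m_eq : m = (n + S (m - n - 1))%nat) by lia.
    assert (G_eq : forall t, 0 < t <= 1 -> t * t ^ (m - n - 1) * F t = c * G t).
    { intros t Ht; specialize (FG t Ht).
      rewrite m_eq, pow_add in FG; simpl in FG.
      apply (Rmult_eq_reg_l (t ^ n)); [lra|].
      pose proof (pow_small t n Ht); lra. }
    assert (c0 : c = 0).
    { apply (zero_of_small c (Rabs (b 0%nat) + KF + Rabs c * KG)); intros t Ht.
      specialize (G_eq t Ht); specialize (F_near t Ht); specialize (G_near t Ht).
      replace c with (t * t ^ (m - n - 1) * F t - c * (G t - 1))
        at 1 by (rewrite G_eq; ring).
      eapply Rle_trans; [apply Rabs_triang|].
      rewrite Rabs_Ropp, !Rabs_mult.
      pose proof (pow_small t (m - n - 1)%nat Ht) as tk.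
      rewrite (Rabs_pos_eq t), (Rabs_pos_eq (t ^ _)) by lra.
      assert (F_bound : Rabs (F t) <= Rabs (b 0%nat) + KF).
      { replace (F t) with (b 0%nat + (F t - b 0%nat)) by ring.
        eapply Rle_trans; [apply Rabs_triang|]. nra. }
      assert (t * t ^ (m - n - 1) * Rabs (F t) <= t * (Rabs (b 0%nat) + KF)).
      { pose proof (Rabs_pos (F t)).
        assert (t ^ (m - n - 1) * Rabs (F t) <= Rabs (F t)) by nra.
        rewrite Rmult_assoc; apply Rmult_le_compat_l; lra. }
      assert (Rabs c * Rabs (G t - 1) <= Rabs c * (KG * t))
        by (apply Rmult_le_compat_l; [apply Rabs_pos | lra]).
      lra. }
    specialize (G_eq 1 ltac:(lra)); specialize (F_gt0 1 ltac:(lra)).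
    rewrite c0, pow1 in G_eq; lra.
  - assert (n_eq : n = (m + S (n - m - 1))%nat) by lia.
    assert (b0 : b 0%nat = 0); [|lra].
    apply (zero_of_small _ (KF + Rabs c * (1 + KG))); intros t Ht.
    specialize (FG t Ht); specialize (F_near t Ht); specialize (G_near t Ht).
    pose proof (pow_small t m Ht) as tm.
    pose proof (pow_small t (n - m - 1)%nat Ht) as tk.
    assert (F_eq : F t = t * (t ^ (n - m - 1) * (c * G t))).
    { rewrite n_eq, pow_add in FG; simpl in FG.
      apply (Rmult_eq_reg_l (t ^ m)); [lra|lra]. }
    replace (b 0%nat) with (F t + - (F t - b 0%nat)) by ring.
    eapply Rle_trans; [apply Rabs_triang|].
    rewrite Rabs_Ropp, F_eq at 1.
    rewrite !Rabs_mult, (Rabs_pos_eq t), (Rabs_pos_eq (t ^ _)) by lra.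
    assert (G_bound : Rabs (G t) <= 1 + KG).
    { replace (G t) with (1 + (G t - 1)) by ring.
      eapply Rle_trans; [apply Rabs_triang|]. rewrite Rabs_R1; nra. }
    assert (Rabs c * Rabs (G t) <= Rabs c * (1 + KG))
      by (apply Rmult_le_compat_l; [apply Rabs_pos | lra]).
    assert (0 <= Rabs c * Rabs (G t))
      by (apply Rmult_le_pos; apply Rabs_pos).
    assert (t ^ (n - m - 1) * (Rabs c * Rabs (G t)) <= Rabs c * (1 + KG)) by nra.
    assert (t * (t ^ (n - m - 1) * (Rabs c * Rabs (G t)))
            <= t * (Rabs c * (1 + KG))) by (apply Rmult_le_compat_l; lra).
    lra.
Qed.

(** * Products of an exponential and linear factors *)

Fixpoint exp_product (beta : R) (y : nat -> R) (N : nat) (t : R) : R :=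
  match N with
  | O => exp (beta * t)
  | S M => exp_product beta y M t * (1 + t * y M)
  end.

(** The coefficient of [t ^ j] in [exp_product beta y N t]. *)
Fixpoint taylor_coef (beta : R) (y : nat -> R) (N j : nat) : R :=
  match N with
  | O => beta ^ j * / INR (fact j)
  | S M => taylor_coef beta y M j
           + y M * match j with O => 0 | S i => taylor_coef beta y M i end
  end.

Fixpoint power_sum (y : nat -> R) (j N : nat) : R :=
  match N with
  | O => 0
  | S M => power_sum y j M + y M ^ j
  end.

Lemma taylor_coef_ge0 (beta : R) (y : nat -> R) :
  0 <= beta -> (forall k, 0 <= y k) ->
  forall N j, 0 <= taylor_coef beta y N j.
Proof.
  intros beta_ge0 y_ge0 N; induction N as [|N IH]; intros j; simpl.
  - apply Rmult_le_pos; [now apply pow_le|].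
    apply Rlt_le, Rinv_0_lt_compat, INR_fact_lt_0.
  - apply Rplus_le_le_0_compat; [apply IH|].
    apply Rmult_le_pos; [apply y_ge0|].
    destruct j; [lra | apply IH].
Qed.

Lemma exp_product_gt0 (beta : R) (y : nat -> R) (N : nat) (t : R) :
  (forall k, 0 <= y k) -> 0 < t -> 0 < exp_product beta y N t.
Proof.
  intros y_ge0 t_gt0; induction N as [|N IH]; simpl; [apply exp_pos|].
  apply Rmult_lt_0_compat; [assumption|].
  pose proof (y_ge0 N); nra.
Qed.

(** Multiplication by [1 + t y] turns the error [r t] into
    [(1 + t y) r t + t ^ 4 y b_3], which again is at most [t ^ 4] times its
    value at 1. *)
Lemma quartic_tail_exp_product (beta : R) (y : nat -> R) :
  0 <= beta -> (forall k, 0 <= y k) ->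
  forall N, quartic_tail (exp_product beta y N) (taylor_coef beta y N).
Proof.
  intros beta_ge0 y_ge0 N; induction N as [|N IH].
  - apply quartic_tail_series.
    + now apply taylor_coef_ge0.
    + intros t t_gt0; simpl.
      apply (is_series_ext (fun k => scal (pow_n (beta * t) k) (/ INR (fact k)))).
      * intros k; rewrite pow_n_pow, Rpow_mult_distr.
        unfold scal; simpl; unfold mult; simpl; ring.
      * apply is_exp_Reals.
  - set (F := exp_product beta y N) in *; set (b := taylor_coef beta y N) in *.
    assert (step : forall t,
      cubic_error (exp_product beta y (S N)) (taylor_coef beta y (S N)) t
      = (1 + t * y N) * cubic_error F b t + t ^ 4 * (y N * b 3%nat)).
    { intros t; unfold cubic_error; simpl; fold b; fold (F t); ring. }
    intros t Ht; rewrite !step.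
    specialize (IH t Ht).
    pose proof (y_ge0 N) as yN.
    assert (b3 : 0 <= b 3%nat) by now apply taylor_coef_ge0.
    assert (t4 : 0 <= t ^ 4) by (apply pow_le; lra).
    assert (yb : 0 <= y N * b 3%nat) by now apply Rmult_le_pos.
    assert (ty : 0 <= t * y N <= y N) by nra.
    split.
    + apply Rplus_le_le_0_compat; apply Rmult_le_pos; lra.
    + assert ((1 + t * y N) * cubic_error F b t
              <= (1 + y N) * (t ^ 4 * cubic_error F b 1))
        by (apply Rmult_le_compat; lra).
      lra.
Qed.

Lemma newton_identities (beta : R) (y : nat -> R) (N : nat) :
  taylor_coef beta y N 0 = 1 /\
  taylor_coef beta y N 1 = beta + power_sum y 1 N /\
  taylor_coef beta y N 1 ^ 2 - 2 * taylor_coef beta y N 2 = power_sum y 2 N /\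
  taylor_coef beta y N 1 ^ 3
    - 3 * taylor_coef beta y N 1 * taylor_coef beta y N 2
    + 3 * taylor_coef beta y N 3 = power_sum y 3 N.
Proof.
  induction N as [|N [e0 [e1 [e2 e3]]]].
  - simpl; repeat split; field.
  - simpl taylor_coef; simpl power_sum; rewrite e0.
    rewrite <- e2, <- e3.
    repeat split; rewrite ?e1; ring.
Qed.

(** * Limits of power sums and the Cauchy-Schwarz inequality *)

Lemma is_lim_power_sum (y : nat -> R) (j : nat) (l : R) :
  is_series (fun k => y k ^ j) l -> is_lim_seq (power_sum y j) l.
Proof.
  intros y_sum; apply is_lim_seq_incr_1.
  apply (is_lim_seq_ext (sum_n (fun k => y k ^ j))); [|exact y_sum].
  intros N; rewrite sum_n_Reals.
  induction N as [|N IH]; simpl in *; [ring | now rewrite IH].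
Qed.

Lemma ex_lim_power_sum (y : nat -> R) (j : nat) :
  (forall k, 0 <= y k) -> ex_series y ->
  exists l : R, is_lim_seq (power_sum y (S j)) l.
Proof.
  intros y_ge0 y_sum.
  enough (ex_series (fun k => y k ^ S j)) as [l l_sum]
    by (exists l; now apply is_lim_power_sum).
  destruct (filterlim_bounded y) as [M y_le].
  { exists 0; now apply ex_series_lim_0. }
  apply (ex_series_le (K := R_AbsRing) (V := R_CompleteNormedModule) _
           (fun k => M ^ j * y k)).
  - intros k.
    change (Rabs (y k ^ S j) <= M ^ j * y k).
    rewrite Rabs_pos_eq by now apply pow_le.
    simpl; rewrite Rmult_comm.
    apply Rmult_le_compat_r; [apply y_ge0|].
    apply pow_incr; split; [apply y_ge0|].
    eapply Rle_trans; [apply Rle_abs | apply y_le].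
  - now apply (ex_series_scal_l (M ^ j) y).
Qed.

Lemma term_le_weighted_squares (y : nat -> R) (s : R) (k N : nat) :
  (forall k, 0 <= y k) -> (k < N)%nat ->
  y k * (s - y k) ^ 2
  <= s ^ 2 * power_sum y 1 N - 2 * s * power_sum y 2 N + power_sum y 3 N.
Proof.
  intros y_ge0.
  assert (expand : forall M,
    s ^ 2 * power_sum y 1 (S M) - 2 * s * power_sum y 2 (S M) + power_sum y 3 (S M)
    = (s ^ 2 * power_sum y 1 M - 2 * s * power_sum y 2 M + power_sum y 3 M)
      + y M * (s - y M) ^ 2) by (intros M; simpl; ring).
  assert (term_ge0 : forall M, 0 <= y M * (s - y M) ^ 2).
  { intros M; apply Rmult_le_pos; [apply y_ge0 | apply pow2_ge_0]. }
  assert (sum_ge0 : forall M,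
    0 <= s ^ 2 * power_sum y 1 M - 2 * s * power_sum y 2 M + power_sum y 3 M).
  { intros M; induction M as [|M IH]; [simpl; lra|].
    rewrite expand; pose proof (term_ge0 M); lra. }
  induction N as [|N IH]; intros k_lt; [lia|].
  rewrite expand.
  destruct (Nat.eq_dec k N) as [->|k_neq].
  - pose proof (sum_ge0 N); lra.
  - pose proof (IH ltac:(lia)); pose proof (term_ge0 N); lra.
Qed.

(** The minimum over [s] of
    [beta s^2 + sum y_k (s - y_k)^2 = p1 s^2 - 2 p2 s + p3], where
    [p1 = beta + S1], is attained at [s = p2 / p1].  It is nonnegative, and if
    it is 0 then so is every term of the sum. *)
Lemma cauchy_schwarz_power_sums (beta : R) (y : nat -> R) (S1 S2 S3 : R) :
  0 <= beta -> (forall k, 0 <= y k) ->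
  is_lim_seq (power_sum y 1) S1 ->
  is_lim_seq (power_sum y 2) S2 ->
  is_lim_seq (power_sum y 3) S3 ->
  0 < beta + S1 ->
  S2 ^ 2 <= (beta + S1) * S3 /\
  (0 < S2 -> S2 ^ 2 = (beta + S1) * S3 ->
   beta = 0 /\ exists s, 0 < s /\ forall k, y k = 0 \/ y k = s).
Proof.
  intros beta_ge0 y_ge0 lim1 lim2 lim3 p1_gt0.
  assert (term_le : forall s k,
    y k * (s - y k) ^ 2 <= s ^ 2 * S1 - 2 * s * S2 + S3).
  { intros s k.
    apply (is_lim_seq_le_loc (fun _ => y k * (s - y k) ^ 2)
             (fun N => s ^ 2 * power_sum y 1 N - 2 * s * power_sum y 2 N
                       + power_sum y 3 N)
             (y k * (s - y k) ^ 2) (s ^ 2 * S1 - 2 * s * S2 + S3)).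
    - exists (S k); intros N k_lt; apply term_le_weighted_squares; [assumption|lia].
    - apply is_lim_seq_const.
    - apply is_lim_seq_plus'; [apply is_lim_seq_minus'|assumption];
        (apply is_lim_seq_mult'; [apply is_lim_seq_const|assumption]). }
  assert (term_ge0 : forall s k, 0 <= y k * (s - y k) ^ 2).
  { intros s k; apply Rmult_le_pos; [apply y_ge0 | apply pow2_ge_0]. }
  set (s := S2 / (beta + S1)).
  assert (min_value : beta * s ^ 2 + (s ^ 2 * S1 - 2 * s * S2 + S3)
    = ((beta + S1) * S3 - S2 ^ 2) / (beta + S1)) by (unfold s; field; lra).
  assert (beta_s : 0 <= beta * s ^ 2)
    by (apply Rmult_le_pos; [assumption | apply pow2_ge_0]).
  split.
  - pose proof (term_le s 0%nat); pose proof (term_ge0 s 0%nat).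
    assert (0 <= ((beta + S1) * S3 - S2 ^ 2) / (beta + S1)) as quot_ge0 by lra.
    apply (Rmult_le_compat_r (beta + S1)) in quot_ge0; [|lra].
    unfold Rdiv in quot_ge0.
    rewrite Rmult_assoc, Rinv_l, Rmult_0_l, Rmult_1_r in quot_ge0 by lra.
    lra.
  - intros S2_gt0 equality.
    assert (s_gt0 : 0 < s) by now apply Rdiv_lt_0_compat.
    replace ((beta + S1) * S3 - S2 ^ 2) with 0 in min_value by lra.
    unfold Rdiv in min_value; rewrite Rmult_0_l in min_value.
    assert (s2_gt0 : 0 < s ^ 2) by now apply pow_lt.
    split.
    + pose proof (term_le s 0%nat); pose proof (term_ge0 s 0%nat); nra.
    + exists s; split; [assumption|intros k].
      pose proof (term_le s k); pose proof (term_ge0 s k).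
      assert (term0 : y k * (s - y k) ^ 2 = 0) by lra.
      apply Rmult_integral in term0 as [|sq0]; [now left|right].
      rewrite <- Rsqr_pow2 in sq0; apply Rsqr_0_uniq in sq0.
      lra.
Qed.

(** A summable sequence tends to 0, so one with values in [{0, s}], [s > 0], has
    only finitely many nonzero terms and the product stops growing. *)
Lemma exp_product_bound_two_values (y : nat -> R) (s : R) :
  ex_series y -> 0 < s -> (forall k, y k = 0 \/ y k = s) ->
  exists K, forall N t, 0 < t -> exp_product 0 y N t <= (1 + s * t) ^ K.
Proof.
  intros y_sum s_gt0 y_values.
  pose proof (ex_series_lim_0 y y_sum) as y_lim.
  apply is_lim_seq_spec in y_lim.
  destruct (y_lim (mkposreal s s_gt0)) as [K y_small]; simpl in y_small.
  exists K; intros N t t_gt0.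
  assert (base : 1 <= 1 + s * t) by nra.
  assert (partial : exp_product 0 y N t <= (1 + s * t) ^ min N K).
  { induction N as [|N IH]; simpl exp_product.
    - rewrite Rmult_0_l, exp_0; simpl; lra.
    - assert (y_ge0 : 0 <= y N) by (destruct (y_values N); lra).
      destruct (Nat.lt_ge_cases N K) as [N_lt|N_ge].
      + rewrite Nat.min_l in * by lia; simpl.
        rewrite (Rmult_comm (1 + s * t)).
        apply Rmult_le_compat.
        * apply Rlt_le, exp_product_gt0; [|assumption].
          intros k; destruct (y_values k); lra.
        * nra.
        * assumption.
        * destruct (y_values N) as [->| ->]; nra.
      + rewrite Nat.min_r in * by lia.
        destruct (y_values N) as [yN|yN]; rewrite yN.
        * rewrite Rmult_0_r, Rplus_0_r, Rmult_1_r; assumption.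
        * specialize (y_small N N_ge).
          rewrite yN, Rminus_0_r, Rabs_pos_eq in y_small; lra. }
  eapply Rle_trans; [exact partial|].
  apply Rle_pow; [assumption | lia].
Qed.

(** In a power series with positive coefficients, the single term of
    degree [K + 1] already outgrows [(1 + s t) ^ K]. *)
Lemma series_not_polynomially_bounded (b : nat -> R) (F : R -> R) (c s : R) (K : nat) :
  (forall k, 0 < b k) ->
  (forall t, 0 < t -> is_series (fun k => b k * t ^ k) (F t)) ->
  0 < c -> 0 < s ->
  ~ (forall t, 0 < t -> F t <= c * (1 + s * t) ^ K).
Proof.
  intros b_gt0 F_sum c_gt0 s_gt0 F_le.
  assert (term_le : forall t, 0 < t -> b (S K) * t ^ S K <= F t).
  { intros t t_gt0.
    apply (is_lim_seq_le_loc (fun _ => b (S K) * t ^ S K)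
             (sum_n (fun k => b k * t ^ k)) (b (S K) * t ^ S K) (F t)).
    - assert (term_gt0 : forall k, 0 < b k * t ^ k).
      { intros k; apply Rmult_lt_0_compat; [apply b_gt0 | now apply pow_lt]. }
      assert (sum_gt0 : forall N, 0 < sum_n (fun k => b k * t ^ k) N).
      { intros N; induction N as [|N IH].
        - rewrite sum_O; apply term_gt0.
        - rewrite sum_Sn; pose proof (term_gt0 (S N)).
          unfold plus; simpl in *; lra. }
      exists (S K); intros N N_ge.
      induction N_ge as [|N N_ge IH].
      + rewrite sum_Sn; pose proof (sum_gt0 K).
        unfold plus; simpl in *; lra.
      + rewrite sum_Sn; pose proof (term_gt0 (S N)).
        unfold plus; simpl in *; lra.
    - apply is_lim_seq_const.
    - exact (F_sum t t_gt0). }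
  set (A := c * (1 + s) ^ K).
  assert (A_gt0 : 0 < A) by (apply Rmult_lt_0_compat; [assumption | apply pow_lt; lra]).
  pose proof (b_gt0 (S K)) as bK.
  set (t := 1 + A / b (S K)).
  assert (t_ge1 : 1 <= t).
  { unfold t; pose proof (Rdiv_lt_0_compat _ _ A_gt0 bK); lra. }
  assert (bt : b (S K) * t = b (S K) + A) by (unfold t; field; lra).
  assert (tK : 0 < t ^ K) by (apply pow_lt; lra).
  assert (upper : (1 + s * t) ^ K <= (1 + s) ^ K * t ^ K).
  { rewrite <- Rpow_mult_distr; apply pow_incr; nra. }
  pose proof (term_le t ltac:(lra)) as lower; simpl in lower.
  pose proof (F_le t ltac:(lra)) as F_t.
  assert (c * (1 + s * t) ^ K <= A * t ^ K).
  { unfold A; rewrite Rmult_assoc; apply Rmult_le_compat_l; lra. }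
  assert (b (S K) * (t * t ^ K) = (b (S K) + A) * t ^ K)
    by (rewrite <- bt; ring).
  nra.
Qed.

(** * Functions of class LP I on the positive axis *)

(** [G] is the limit of the products [exp (beta t) * prod (1 + t y_k)] on the
    positive axis.  The [y_k] are the reciprocals of the [x_k], padded with
    zeros when the product is finite, so that one form covers both cases. *)
Definition exp_product_limit (beta : R) (y : nat -> R) (G : R -> R) : Prop :=
  0 <= beta /\ (forall k, 0 <= y k) /\ ex_series y /\
  forall t, 0 < t -> is_lim_seq (fun N => exp_product beta y N t) (G t).

Lemma exp_product_scale (beta : R) (y : nat -> R) (N : nat) (t : R) :
  exp_product beta y N t = exp (beta * t) * exp_product 0 y N t.
Proof.
  induction N as [|N IH]; simpl.
  - rewrite Rmult_0_l, exp_0; ring.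
  - rewrite IH; ring.
Qed.

Lemma linear_factors_real (x : nat -> R) (t : R) (N : nat) :
  (forall k, (k < N)%nat -> 0 < x k) ->
  linear_factors x N (RtoC t) = RtoC (exp_product 0 (fun k => / x k) N t).
Proof.
  induction N as [|N IH]; intros x_gt0; simpl.
  - now rewrite Rmult_0_l, exp_0.
  - rewrite IH by (intros k k_lt; apply x_gt0; lia).
    assert (x N <> 0) by (pose proof (x_gt0 N ltac:(lia)); lra).
    rewrite RtoC_mult, RtoC_plus, RtoC_mult, RtoC_inv by assumption.
    reflexivity.
Qed.

Lemma ex_series_finitely_supported (y : nat -> R) (N : nat) :
  (forall k, (N <= k)%nat -> y k = 0) -> ex_series y.
Proof.
  intros y0; apply (ex_series_incr_n y N).
  apply (ex_series_ext (fun k => 0 * (/ 2) ^ k)).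
  - intros k; rewrite y0 by lia; apply Rmult_0_l.
  - apply (ex_series_scal_l 0 (fun k => (/ 2) ^ k)), ex_series_geom.
    rewrite Rabs_pos_eq; lra.
Qed.

Lemma finite_LP1_product_real (P : C -> C) :
  finite_LP1_product P ->
  exists y, exp_product_limit 0 y (fun t => Re (P (RtoC t))).
Proof.
  intros [N [x [x_gt0 P_eq]]].
  set (y := fun k => if (k <? N)%nat then / x k else 0).
  assert (y_tail : forall k, (N <= k)%nat -> y k = 0).
  { intros k k_ge; unfold y; destruct (Nat.ltb_spec k N); [lia|reflexivity]. }
  exists y; repeat split.
  - lra.
  - intros k; unfold y; destruct (Nat.ltb_spec k N); [|lra].
    now apply Rlt_le, Rinv_0_lt_compat, x_gt0.
  - now apply ex_series_finitely_supported with N.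
  - intros t t_gt0.
    rewrite P_eq, linear_factors_real, re_RtoC by assumption.
    assert (below : forall M, (M <= N)%nat ->
      exp_product 0 y M t = exp_product 0 (fun k => / x k) M t).
    { induction M as [|M IH]; intros M_le; simpl; [reflexivity|].
      rewrite IH by lia; unfold y at 1.
      destruct (Nat.ltb_spec M N); [reflexivity|lia]. }
    rewrite <- (below N) by lia.
    apply (is_lim_seq_ext_loc (fun _ => exp_product 0 y N t));
      [|apply is_lim_seq_const].
    exists N; intros M M_ge; induction M_ge as [|M M_ge IH]; [reflexivity|].
    simpl; rewrite <- IH, (y_tail M M_ge); ring.
Qed.

Lemma filterlim_Re (z : C) : filterlim Re (locally z) (locally (Re z)).
Proof. destruct z as [u v]; apply (continuous_fst u v). Qed.

Lemma infinite_LP1_product_real (P : C -> C) :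
  infinite_LP1_product P ->
  exists y, exp_product_limit 0 y (fun t => Re (P (RtoC t))).
Proof.
  intros [x [x_gt0 [x_sum P_lim]]].
  exists (fun k => / x k); repeat split.
  - lra.
  - intros k; now apply Rlt_le, Rinv_0_lt_compat.
  - assumption.
  - intros t t_gt0.
    apply (is_lim_seq_ext (fun N => Re (linear_factors x N (RtoC t)))).
    + intros N; rewrite linear_factors_real by auto; apply re_RtoC.
    + exact (filterlim_comp _ _ _ _ _ _ _ _ (P_lim (RtoC t)) (filterlim_Re _)).
Qed.

Lemma LP1_on_positive_axis (h : C -> C) :
  LP1 h ->
  exists c n beta y G,
    exp_product_limit beta y G /\
    forall t, 0 < t -> Re (h (RtoC t)) = c * t ^ n * G t.
Proof.
  intros [_ [c [n [beta [P [beta_ge0 [P_prod h_eq]]]]]]].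
  assert (exists y, exp_product_limit 0 y (fun t => Re (P (RtoC t))))
    as [y [_ [y_ge0 [y_sum P_lim]]]].
  { destruct P_prod;
      [now apply finite_LP1_product_real | now apply infinite_LP1_product_real]. }
  exists c, n, beta, y, (fun t => exp (beta * t) * Re (P (RtoC t))).
  split; [repeat split; [assumption..|]|].
  - intros t t_gt0.
    apply (is_lim_seq_ext (fun N => exp (beta * t) * exp_product 0 y N t)).
    + intros N; now rewrite <- exp_product_scale.
    + apply is_lim_seq_mult'; [apply is_lim_seq_const | now apply P_lim].
  - intros t t_gt0.
    assert (exp_real : Cexp (RtoC beta * RtoC t) = RtoC (exp (beta * t))).
    { unfold Cexp; rewrite <- RtoC_mult, re_RtoC, im_RtoC, cos_0, sin_0.
      unfold RtoC; f_equal; ring. }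
    rewrite h_eq, exp_real, <- RtoC_pow, <- !RtoC_mult, re_scal_l; ring.
Qed.

(** Newton's identities, solved for the Taylor coefficients, make those
    coefficients converge along with the power sums; the limits [e] then inherit
    the quartic tail. *)
Lemma exp_product_limit_taylor (beta : R) (y : nat -> R) (G : R -> R) :
  exp_product_limit beta y G ->
  exists (e : nat -> R) (S1 S2 S3 : R),
    quartic_tail G e /\
    is_lim_seq (power_sum y 1) S1 /\
    is_lim_seq (power_sum y 2) S2 /\
    is_lim_seq (power_sum y 3) S3 /\
    e 0%nat = 1 /\ e 1%nat = beta + S1 /\
    e 1%nat ^ 2 - 2 * e 2%nat = S2 /\
    e 1%nat ^ 3 - 3 * e 1%nat * e 2%nat + 3 * e 3%nat = S3.
Proof.
  intros [beta_ge0 [y_ge0 [y_sum G_lim]]].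
  destruct (ex_lim_power_sum y 0 y_ge0 y_sum) as [S1 y1].
  destruct (ex_lim_power_sum y 1 y_ge0 y_sum) as [S2 y2].
  destruct (ex_lim_power_sum y 2 y_ge0 y_sum) as [S3 y3].
  set (e1 := beta + S1).
  set (e2 := (e1 ^ 2 - S2) * / 2).
  set (e3 := (S3 - e1 ^ 3 + 3 * e1 * e2) * / 3).
  exists (fun j => match j with 0%nat => 1 | 1%nat => e1 | 2%nat => e2 | _ => e3 end).
  exists S1, S2, S3.
  assert (lim1 : is_lim_seq (fun N => taylor_coef beta y N 1) e1).
  { apply (is_lim_seq_ext (fun N => beta + power_sum y 1 N)).
    - intros N; symmetry; apply newton_identities.
    - apply is_lim_seq_plus'; [apply is_lim_seq_const | assumption]. }
  assert (lim_pow : forall k, is_lim_seq (fun N => taylor_coef beta y N 1 ^ k) (e1 ^ k)).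
  { induction k as [|k IH]; simpl; [apply is_lim_seq_const|].
    now apply is_lim_seq_mult'. }
  assert (lim2 : is_lim_seq (fun N => taylor_coef beta y N 2) e2).
  { apply (is_lim_seq_ext
      (fun N => (taylor_coef beta y N 1 ^ 2 - power_sum y 2 N) * / 2)).
    - intros N; destruct (newton_identities beta y N) as [_ [_ [<- _]]]; field.
    - apply is_lim_seq_mult'; [|apply is_lim_seq_const].
      now apply is_lim_seq_minus'. }
  assert (lim3 : is_lim_seq (fun N => taylor_coef beta y N 3) e3).
  { apply (is_lim_seq_ext
      (fun N => (power_sum y 3 N - taylor_coef beta y N 1 ^ 3
                 + 3 * taylor_coef beta y N 1 * taylor_coef beta y N 2) * / 3)).
    - intros N; destruct (newton_identities beta y N) as [_ [_ [_ <-]]]; field.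
    - apply is_lim_seq_mult'; [|apply is_lim_seq_const].
      apply is_lim_seq_plus'; [now apply is_lim_seq_minus'|].
      apply is_lim_seq_mult'; [|assumption].
      apply is_lim_seq_mult'; [apply is_lim_seq_const | assumption]. }
  split; [|split; [exact y1|split; [exact y2|split; [exact y3|]]];
           unfold e3, e2; repeat split; field].
  apply (quartic_tail_lim (exp_product beta y) (taylor_coef beta y)).
  - now apply quartic_tail_exp_product.
  - assumption.
  - intros j j_le3; destruct j as [|[|[|[|j]]]]; try assumption; [|lia].
    apply (is_lim_seq_ext (fun _ => 1)); [|apply is_lim_seq_const].
    intros N; symmetry; apply newton_identities.
Qed.

(** * Inequalities between consecutive second quotients *)

(** With [q] and [q'] the first two second quotients of [b], these are
    [q >= 2] and [q + 3 / q' >= 4], multiplied out: [p2 >= 0] and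
    [p1 p3 >= p2^2] for the power sums of [G]. *)
Lemma laguerre_polya_coefficient_inequalities
    (b : nat -> R) (F G : R -> R) (c : R) (n : nat) (m : nat)
    (beta : R) (y : nat -> R) :
  (forall k, 0 < b k) ->
  (forall t, 0 < t -> is_series (fun k => b k * t ^ k) (F t)) ->
  exp_product_limit beta y G ->
  (forall t, 0 < t -> t ^ m * F t = c * t ^ n * G t) ->
  2 * (b 0%nat * b 2%nat) <= b 1%nat ^ 2 /\
  4 * b 0%nat * b 2%nat ^ 2
  <= b 1%nat ^ 2 * b 2%nat + 3 * b 0%nat * b 1%nat * b 3%nat /\
  (2 * (b 0%nat * b 2%nat) < b 1%nat ^ 2 ->
   4 * b 0%nat * b 2%nat ^ 2
   < b 1%nat ^ 2 * b 2%nat + 3 * b 0%nat * b 1%nat * b 3%nat).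
Proof.
  intros b_gt0 F_sum G_lim FG.
  destruct (exp_product_limit_taylor beta y G G_lim)
    as [e [S1 [S2 [S3 [G_tail [lim1 [lim2 [lim3 [e0 [e1 [e2 e3]]]]]]]]]]].
  destruct G_lim as [beta_ge0 [y_ge0 [y_sum G_lim]]].
  assert (F_tail : quartic_tail F b).
  { apply quartic_tail_series; [intros k; apply Rlt_le, b_gt0 | assumption]. }
  pose proof (b_gt0 0%nat) as b0_gt0; pose proof (b_gt0 1%nat) as b1_gt0.
  assert (F_gt0 : forall t, 0 < t <= 1 -> 0 < F t).
  { intros t Ht; destruct (F_tail t Ht) as [error_ge0 _]; unfold cubic_error in error_ge0.
    assert (pos : forall k, 0 < b k * t ^ k).
    { intros k; apply Rmult_lt_0_compat; [apply b_gt0 | apply pow_lt; lra]. }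
    pose proof (pos 1%nat); pose proof (pos 2%nat); pose proof (pos 3%nat).
    rewrite pow_1 in *; lra. }
  assert (n_eq : n = m).
  { apply (vanishing_order_unique F G b e c m n); try assumption.
    intros t Ht; apply FG; lra. }
  subst n.
  assert (F_eq : forall t, 0 < t -> F t = c * G t).
  { intros t t_gt0; apply (Rmult_eq_reg_l (t ^ m)).
    - rewrite (FG t t_gt0); ring.
    - apply Rgt_not_eq, pow_lt; assumption. }
  assert (b_eq : forall j, (j <= 3)%nat -> b j = c * e j).
  { apply (cubic_coefficients_unique F G); try assumption.
    intros t Ht; apply F_eq; lra. }
  pose proof (b_eq 0%nat ltac:(lia)) as b0; rewrite e0, Rmult_1_r in b0.
  pose proof (b_eq 1%nat ltac:(lia)) as b1.
  pose proof (b_eq 2%nat ltac:(lia)) as b2.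
  pose proof (b_eq 3%nat ltac:(lia)) as b3.
  assert (c_gt0 : 0 < c) by lra.
  assert (p1_gt0 : 0 < beta + S1) by (rewrite <- e1; nra).
  destruct (cauchy_schwarz_power_sums beta y S1 S2 S3) as [cs cs_eq]; try assumption.
  assert (S2_ge0 : 0 <= S2).
  { apply (is_lim_seq_le (fun _ => 0) (power_sum y 2) 0 S2); [|apply is_lim_seq_const|assumption].
    intros N; induction N as [|N IH]; simpl power_sum; [lra|].
    pose proof (pow2_ge_0 (y N)); lra. }
  assert (c2_gt0 : 0 < c ^ 2) by now apply pow_lt.
  assert (c3_gt0 : 0 < c ^ 3) by now apply pow_lt.
  assert (first : b 1%nat ^ 2 - 2 * (b 0%nat * b 2%nat) = c ^ 2 * S2).
  { rewrite b0, b1, b2, <- e2; ring. }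
  assert (second : b 1%nat ^ 2 * b 2%nat + 3 * b 0%nat * b 1%nat * b 3%nat
                   - 4 * b 0%nat * b 2%nat ^ 2
                   = c ^ 3 * ((beta + S1) * S3 - S2 ^ 2)).
  { rewrite b0, b1, b2, b3, <- e1, <- e2, <- e3; ring. }
  split; [nra|split; [nra|intros strict]].
  assert (S2_gt0 : 0 < S2) by nra.
  destruct (Rle_lt_or_eq_dec _ _ cs) as [cs_lt|equality]; [nra|exfalso].
  destruct (cs_eq S2_gt0 equality) as [beta0 [s [s_gt0 y_values]]].
  destruct (exp_product_bound_two_values y s y_sum s_gt0 y_values) as [K bound].
  apply (series_not_polynomially_bounded b F c s K); try assumption.
  intros t t_gt0; rewrite (F_eq t t_gt0).
  apply Rmult_le_compat_l; [lra|].
  apply (is_lim_seq_le (fun N => exp_product beta y N t)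
           (fun _ => (1 + s * t) ^ K) (G t) ((1 + s * t) ^ K)).
  - intros N; rewrite beta0; now apply bound.
  - now apply G_lim.
  - apply is_lim_seq_const.
Qed.

Lemma entire_expansion_real (f : C -> C) (a : nat -> R) (t : R) :
  entire_expansion f a -> ex_series (fun k => a k * t ^ k).
Proof.
  intros f_entire; exists (Re (f (RtoC t))).
  pose proof (filterlim_comp _ _ _ _ _ _ _ _ (f_entire (RtoC t)) (filterlim_Re _))
    as Re_lim.
  refine (filterlim_ext _ _ _ Re_lim); intros N; cbv beta.
  assert (term : forall k,
    Re (scal (pow_n (RtoC t) k) (RtoC (a k))) = a k * t ^ k).
  { intros k; replace (pow_n (RtoC t) k) with (RtoC (t ^ k)).
    - change (Re (RtoC (t ^ k) * RtoC (a k)) = a k * t ^ k).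
      rewrite re_scal_l, re_RtoC; ring.
    - induction k as [|k IH]; simpl; [reflexivity|].
      rewrite <- IH; apply RtoC_mult. }
  induction N as [|N IH].
  - rewrite !sum_O; apply term.
  - rewrite !sum_Sn.
    change (Re (?u + ?v)%C) with (Re u + Re v).
    rewrite <- (term (S N)), <- IH; reflexivity.
Qed.

Lemma remainder_real (f : C -> C) (a : nat -> R) (l : nat) (t : R) :
  entire_expansion f a -> 0 < t ->
  is_series (fun k => a (l + k)%nat * t ^ k)
            (Series (fun k => a (l + k)%nat * t ^ k)) /\
  Re (remainder a l (RtoC t)) = t ^ l * Series (fun k => a (l + k)%nat * t ^ k).
Proof.
  intros f_entire t_gt0; split.
  - apply Series_correct.
    pose proof (entire_expansion_real f a t f_entire) as a_sum.
    apply (ex_series_incr_n _ l) in a_sum.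
    apply (ex_series_scal_l (/ t ^ l)) in a_sum.
    refine (ex_series_ext _ _ _ a_sum); intros k.
    unfold scal; simpl; unfold mult; simpl; rewrite pow_add; field.
    apply pow_nonzero; lra.
  - change (Re (remainder a l (RtoC t)))
      with (Series (fun k => Re (RtoC (a (l + k)%nat) * RtoC t ^ (l + k))%C)).
    rewrite <- Series_scal_l; apply Series_ext; intros k.
    rewrite <- RtoC_pow, <- RtoC_mult, re_RtoC, pow_add; ring.
Qed.

Lemma LP1_remainder_inequalities (f : C -> C) (a : nat -> R) (l : nat) :
  entire_expansion f a -> (forall k, 0 < a k) -> LP1 (remainder a l) ->
  2 * (a l * a (l + 2)%nat) <= a (l + 1)%nat ^ 2 /\
  4 * a l * a (l + 2)%nat ^ 2
  <= a (l + 1)%nat ^ 2 * a (l + 2)%nat + 3 * a l * a (l + 1)%nat * a (l + 3)%nat /\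
  (2 * (a l * a (l + 2)%nat) < a (l + 1)%nat ^ 2 ->
   4 * a l * a (l + 2)%nat ^ 2
   < a (l + 1)%nat ^ 2 * a (l + 2)%nat + 3 * a l * a (l + 1)%nat * a (l + 3)%nat).
Proof.
  intros f_entire a_pos rem_LP1.
  destruct (LP1_on_positive_axis _ rem_LP1) as [c [n [beta [y [G [G_lim rem_eq]]]]]].
  pose proof (laguerre_polya_coefficient_inequalities (fun k => a (l + k)%nat)
    (fun t => Series (fun k => a (l + k)%nat * t ^ k)) G c n l beta y) as ineqs.
  simpl in ineqs; rewrite Nat.add_0_r in ineqs; apply ineqs.
  - intros k; apply a_pos.
  - intros t t_gt0; now apply (remainder_real f a l t).
  - assumption.
  - intros t t_gt0; rewrite <- rem_eq by assumption.
    symmetry; now apply (remainder_real f a l t).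
Qed.

(** A gap below 3 grows by a factor 3/2 at each step. *)
Lemma recursive_bound_ge_3 (q : nat -> R) :
  (forall m, 2 <= q m) ->
  (forall m, 4 * q (S m) <= q m * q (S m) + 3) ->
  forall m, 3 <= q m.
Proof.
  intros q_ge2 q_rec m.
  apply Rnot_lt_le; intros q_lt3.
  assert (gap : forall j, 3 - q m <= 3 - q (j + m)%nat /\
    (1 + INR j * / 2) * (3 - q m) <= 3 - q (j + m)%nat).
  { induction j as [|j [IH1 IH2]]; [simpl; split; lra|].
    pose proof (q_ge2 (j + m)%nat); pose proof (q_rec (j + m)%nat).
    assert (3 / 2 * (3 - q (j + m)%nat) <= 3 - q (S (j + m))).
    { apply (Rmult_le_reg_r (4 - q (j + m)%nat)); nra. }
    rewrite S_INR; change (S j + m)%nat with (S (j + m)); split; lra. }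
  destruct (INR_unbounded (2 / (3 - q m))) as [j j_gt].
  destruct (gap j) as [_ gap_j]; pose proof (q_ge2 (j + m)%nat).
  apply (Rmult_lt_compat_r (3 - q m)) in j_gt; [|lra].
  unfold Rdiv in j_gt; rewrite Rmult_assoc, Rinv_l in j_gt by lra.
  nra.
Qed.

Theorem theorem1p14 (f : C -> C) (a : nat -> R)
  (f_entire : entire_expansion f a)
  (a_pos : forall k : nat, 0 < a k)
  (remainders_LP1 : forall l : nat, LP1 (remainder a l)) :
  forall n : nat, (2 <= n)%nat -> second_quotient a n > 3.
Proof.
  set (q := fun l => a (l + 1)%nat ^ 2 / (a l * a (l + 2)%nat)).
  assert (q_spec : forall l, q l * (a l * a (l + 2)%nat) = a (l + 1)%nat ^ 2).
  { intros l; unfold q; field.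
    split; apply Rgt_not_eq, a_pos. }
  assert (q_ge2 : forall l, 2 <= q l).
  { intros l.
    destruct (LP1_remainder_inequalities f a l f_entire a_pos (remainders_LP1 l))
      as [ineq _].
    rewrite <- q_spec in ineq.
    apply (Rmult_le_reg_r (a l * a (l + 2)%nat)); [|assumption].
    now apply Rmult_lt_0_compat. }
  assert (q_next : forall l,
    (q l * q (S l) + 3 - 4 * q (S l)) * (a l * (a (l + 1)%nat * a (l + 3)%nat))
    = a (l + 1)%nat ^ 2 * a (l + 2)%nat + 3 * a l * a (l + 1)%nat * a (l + 3)%nat
      - 4 * a l * a (l + 2)%nat ^ 2).
  { intros l; unfold q.
    replace (S l + 1)%nat with (l + 2)%nat by lia.
    replace (S l + 2)%nat with (l + 3)%nat by lia.
    replace (S l) with (l + 1)%nat by lia.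
    field; repeat split; apply Rgt_not_eq, a_pos. }
  assert (q_rec : forall l, 4 * q (S l) <= q l * q (S l) + 3 /\
                            (2 < q l -> 4 * q (S l) < q l * q (S l) + 3)).
  { intros l.
    destruct (LP1_remainder_inequalities f a l f_entire a_pos (remainders_LP1 l))
      as [_ [weak strict]].
    pose proof (q_next l) as next.
    assert (den_gt0 : 0 < a l * (a (l + 1)%nat * a (l + 3)%nat))
      by (repeat apply Rmult_lt_0_compat; apply a_pos).
    split; [nra|intros q_gt2].
    assert (0 < a l * a (l + 2)%nat) by now apply Rmult_lt_0_compat.
    rewrite <- q_spec in strict.
    pose proof (strict ltac:(now apply Rmult_lt_compat_r)) as strict_l.
    rewrite q_spec in strict_l; nra. }
  assert (q_ge3 : forall l, 3 <= q l).
  { apply recursive_bound_ge_3; [assumption | apply q_rec]. }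
  intros n n_ge2.
  replace (second_quotient a n) with (q (n - 2)%nat).
  - pose proof (q_ge3 (n - 2)%nat); pose proof (q_ge3 (S (n - 2))).
    pose proof (proj2 (q_rec (n - 2)%nat) ltac:(lra)); nra.
  - unfold q, second_quotient.
    now replace (n - 2 + 1)%nat with (n - 1)%nat by lia;
      replace (n - 2 + 2)%nat with n by lia.
Qed.
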